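(* Let $T=[t_1,t_2]$ and let $(P_t)_{t\in T}$ with densities $p(\cdot,t)$ with respect to a $\sigma$-finite measure $\nu$ satisfy: $p$ is measurable, $t\mapsto p(x,t)$ is absolutely continuous for $\nu$-a.e. $x$, the Fisher information $\mathcal{I}(t):=\int_{\mathcal{X}}(\partial_t p(x,t))^2/p(x,t)\,d\nu(x)$ is finite for all $t$ with $\int_T\mathcal{I}<\infty$, and $\mathcal{I}$ is absolutely continuous on $T$. Let $p,q>1$ with $1/p+1/q=1$, and let $\rho_t(x):=\partial_t p(x,t)/p(x,t)$ be such that $t\mapsto\mathbb{E}_{P_t}[|\rho_t(\boldsymbol{X})|^q]$ is finite and integrable over $T$. Let $\mathcal{A}$ be the class of functions $\alpha:T\to\mathbb{R}$ that are absolutely continuous with weak derivative $\alpha'$ such that $(\alpha')^2$ is absolutely continuous, and satisfy $\alpha(t_1)=\alpha(t_2)=0$. Then for every measurable $\hat t:\mathcal{X}\to\mathbb{R}$, $$\sup_{t\in T}\mathbb{E}_{P_t}\bigl[|\hat t(\boldsymbol{X})-t|^p\bigr]\ge\sup_{\alpha\in\mathcal{A}}\left(\frac{\bigl|\int_T\alpha(t)\,dt\bigr|}{\int_T\bigl\{\mathbb{E}_{P_t}\bigl[|\alpha'(t)+\alpha(t)\rho_t(\boldsymbol{X})|^q\bigr]\bigr\}^{1/q}dt}\right)^p.$$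
   Context: $\mathbb{E}_{P_t}$ denotes expectation with $\boldsymbol{X}\sim P_t$. *)

(* Defs.v *)
From HB Require Import structures.
From mathcomp Require Import all_boot all_order all_algebra.
From mathcomp Require Import all_classical all_reals all_analysis.
Set Implicit Arguments. Unset Strict Implicit. Unset Printing Implicit Defensive.
Import Order.TTheory GRing.Theory Num.Theory.
Import numFieldNormedType.Exports.
Local Open Scope classical_set_scope.
Local Open Scope ring_scope.

Definition abs_cont_on {R : realType} (a b : R) (f : R -> R) : Prop :=
  forall e : R, 0 < e -> exists2 d : R, 0 < d &
    forall (n : nat) (s : 'I_n -> R * R),
      (forall i, a <= (s i).1 /\ (s i).1 <= (s i).2 /\ (s i).2 <= b) ->
      (forall i j, i != j -> (s i).2 <= (s j).1 \/ (s j).2 <= (s i).1) ->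
      \sum_(i < n) ((s i).2 - (s i).1) < d ->
      \sum_(i < n) `|f (s i).2 - f (s i).1| < e.

Definition Expt {R : realType} {d} {X : measurableType d}
  (nu : {measure set X -> \bar R}) (p : X -> R -> R) (t : R) (f : X -> R)
  : \bar R :=
  (\int[nu]_x (f x * p x t)%:E)%E.

Definition fisher {R : realType} {d} {X : measurableType d}
  (nu : {measure set X -> \bar R}) (p : X -> R -> R) (t : R) : \bar R :=
  (\int[nu]_x (((derive1 (p x) t) ^+ 2 / p x t)%:E))%E.

Definition score {R : realType} {X : Type} (p : X -> R -> R) (t : R) (x : X)
  : R := derive1 (p x) t / p x t.

Definition weak_deriv_on {R : realType} (t1 t2 : R) (a a' : R -> R) : Prop :=
  (@lebesgue_measure R).-integrable `[t1, t2]%classic (EFin \o a')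
  /\ forall t, t \in `[t1, t2] ->
     ((a t)%:E = (a t1)%:E + \int[lebesgue_measure]_(s in `[t1, t]%classic) (a' s)%:E)%E.

Definition classA {R : realType} (t1 t2 : R) (a a' : R -> R) : Prop :=
  [/\ abs_cont_on t1 t2 a, weak_deriv_on t1 t2 a a',
      abs_cont_on t1 t2 (fun t => a' t ^+ 2), a t1 = 0 & a t2 = 0].

(* Main.v *)
Require Import Defs.
From HB Require Import structures.
From mathcomp Require Import all_boot all_order all_algebra.
From mathcomp Require Import all_classical all_reals all_analysis.
From mathcomp Require Import measurable_realfun lra.
Set Implicit Arguments. Unset Strict Implicit. Unset Printing Implicit Defensive.
Import Order.TTheory GRing.Theory Num.Theory.
Import numFieldNormedType.Exports.
Local Open Scope classical_set_scope.
Local Open Scope ring_scope.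

(**
For almost every [x] the function [t |-> a t * p x t * (th x - t)] is absolutely
continuous and vanishes at both endpoints, so its derivative has integral [0]:
[\int a p(x, .) = \int (a' + a * score) p(x, .) (th x - t)]. Integrating over
[x] with Fubini, Hoelder's inequality for the weight [p(., t)] bounds
[|\int a|] by [(sup risk)^(1/p)] times the denominator.

Absolutely continuous functions are handled through the Jordan decomposition:
the Lebesgue-Stieltjes measure of a monotone absolutely continuous function is
dominated by the Lebesgue measure, hence has a Radon-Nikodym density, which is
the derivative almost everywhere by Lebesgue's differentiation theorem.

The integrands of the statement involve [derive1 (p x) t], which need not be
measurable on null sets. They are compared with a jointly measurable version
[mderiv]; the comparison only uses that the integral of a nonnegative,
possibly nonmeasurable function is a supremum over simple functions.
*)

(** * Absolute continuity on an interval and total variation *)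

Section absolute_continuity.
Context {R : realType}.
Implicit Types (a b c d e : R) (f g : R -> R) (u v : R * R) (s : seq (R * R)).

Definition sub_itv a b u : bool := [&& a <= u.1, u.1 <= u.2 & u.2 <= b].

Definition disj_itv u v : bool := (u.2 <= v.1) || (v.2 <= u.1).

(** Sequences replace the families indexed by ['I_n], so that intervals can be concatenated, refined
    and handled by induction. *)
Lemma abs_cont_on_seq a b f e : abs_cont_on a b f -> 0 < e ->
  exists2 d : R, 0 < d & forall s, all (sub_itv a b) s -> pairwise disj_itv s ->
    \sum_(u <- s) (u.2 - u.1) < d -> \sum_(u <- s) `|f u.2 - f u.1| < e.
Proof.
move=> acf e0; have [d d0 H] := acf _ e0; exists d => // s /all_nthP ss sd.
rewrite !(big_nth (a, a)) !big_mkord.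
apply: (H (size s) (fun i => nth (a, a) s i)).
  by move=> i; have /and3P[] := ss (a, a) i (ltn_ord i).
move=> i j ij.
have {}sd := @pairwiseP _ disj_itv (a, a) s sd.
case: (ltngtP i j) => [lt_ij|lt_ji|/val_inj/eqP]; last by rewrite (negbTE ij).
- by apply/orP; exact: (sd i j (ltn_ord i) (ltn_ord j)).
- by apply/orP; rewrite orbC; exact: (sd j i (ltn_ord j) (ltn_ord i)).
Qed.

Lemma abs_cont_on_dist a b f e : abs_cont_on a b f -> 0 < e ->
  exists2 d : R, 0 < d & forall x y, a <= x <= b -> a <= y <= b ->
    `|x - y| < d -> `|f x - f y| < e.
Proof.
move=> /abs_cont_on_seq H /H[d d0 {}H]; exists d => // x y.
wlog xy : x y / x <= y.
  move=> h xab yab; have [/h|/ltW/h] := leP x y; first exact.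
  by rewrite distrC (distrC (f x)); exact.
move=> /andP[ax xb] /andP[ay yb]; rewrite distrC ger0_norm ?subr_ge0// => xyd.
have := H [:: (x, y)]; rewrite !big_seq1/= /sub_itv/= ax xy yb distrC.
exact.
Qed.

(** Common source of the closure under products and differences: one modulus serves for [f], one for
    [g], and their minimum serves for [h]. *)
Lemma abs_cont_on_lin a b f g h (K M : R) : 0 <= K -> 0 <= M ->
  abs_cont_on a b f -> abs_cont_on a b g ->
  (forall x y, a <= x <= b -> a <= y <= b ->
    `|h x - h y| <= K * `|f x - f y| + M * `|g x - g y|) ->
  abs_cont_on a b h.
Proof.
move=> K0 M0 acf acg hfg e e0.
(* Dividing by [K + 1] and [M + 1] keeps the tolerances well defined when [K] or [M] is [0]. *)
have K1 : 0 < K + 1 by rewrite ltr_wpDl.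
have M1 : 0 < M + 1 by rewrite ltr_wpDl.
have e2K : 0 < e / 2 / (K + 1) by rewrite !divr_gt0.
have e2M : 0 < e / 2 / (M + 1) by rewrite !divr_gt0.
have [d1 d10 H1] := acf _ e2K; have [d2 d20 H2] := acg _ e2M.
exists (Num.min d1 d2); first by rewrite lt_min d10.
move=> n s sS sd; rewrite lt_min => /andP[sd1 sd2].
have {H1}  := H1 _ _ sS sd sd1; rewrite ltr_pdivlMr// => H1.
have {H2}  := H2 _ _ sS sd sd2; rewrite ltr_pdivlMr// => H2.
apply: (@le_lt_trans _ _ (K * (\sum_(i < n) `|f (s i).2 - f (s i).1|) +
   M * (\sum_(i < n) `|g (s i).2 - g (s i).1|))).
  rewrite !mulr_sumr -big_split/=; apply: ler_sum => i _.
  have [? [? ?]] := sS i.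
  apply: hfg; lra.
have f0 : 0 <= \sum_(i < n) `|f (s i).2 - f (s i).1| by apply: sumr_ge0.
have g0 : 0 <= \sum_(i < n) `|g (s i).2 - g (s i).1| by apply: sumr_ge0.
move: H1 H2 f0 g0; set F := \sum_(i < n) _; set G := \sum_(i < n) _; nra.
Qed.

(** With [d] the modulus for tolerance [1], walk from [a] in steps of length [d / 2]; each step
    changes [f] by less than [1], and finitely many reach [b]. *)
Lemma abs_cont_on_bounded a b f : abs_cont_on a b f ->
  exists2 M : R, 0 <= M & forall x, a <= x <= b -> `|f x| <= M.
Proof.
move=> acf; have [d d0 H] := abs_cont_on_dist acf ltr01.
have step n : forall x, a <= x <= b -> x - a <= n%:R * (d / 2) ->
    `|f x| <= `|f a| + n%:R.
  elim: n => [|n IH] x /andP[ax xb].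
    rewrite mul0r subr_le0 => xa; have -> : x = a by apply/le_anti; rewrite xa ax.
    by rewrite addr0.
  rewrite -natr1 mulrDl mul1r => xn.
  (* The previous point of the walk, cut off at [a] so as to stay in the interval. *)
  have := IH (Num.max a (x - d / 2)).
  have -> : a <= Num.max a (x - d / 2) <= b.
    by rewrite le_max lexx/= ge_max; apply/andP; split; lra.
  have n0 : 0 <= n%:R * (d / 2) by rewrite mulr_ge0// divr_ge0// ltW.
  have -> : Num.max a (x - d / 2) - a <= n%:R * (d / 2).
    by rewrite lerBlDl ge_max; apply/andP; split; lra.
  move=> /(_ erefl erefl) h.
  have := H (Num.max a (x - d / 2)) x.
  have -> : a <= Num.max a (x - d / 2) <= b.
    by rewrite le_max lexx/= ge_max; apply/andP; split; lra.
  have -> : `|Num.max a (x - d / 2) - x| < d.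
    rewrite distrC ger0_norm ?subr_ge0 ?ge_max ?ax/=; last lra.
    by rewrite ltrBlDr -ltrBlDl lt_max; apply/orP; right; lra.
  rewrite ax xb => /(_ erefl erefl erefl) h2.
  rewrite addrA; apply: (le_trans _ (lerD h (ltW h2))).
  by rewrite distrC -{1}(subrK (f (Num.max a (x - d / 2))) (f x)) addrC ler_normD.
have [n Hn] : exists n : nat, b - a <= n%:R * (d / 2).
  exists (Num.truncn ((b - a) / (d / 2))).+1.
  by rewrite -ler_pdivrMr ?divr_gt0// ltW// truncnS_gt.
exists (`|f a| + n%:R) => [|x /andP[ax xb]]; first by rewrite addr_ge0.
by apply: step; [rewrite ax|apply: (le_trans _ Hn); rewrite lerD2r].
Qed.

Lemma abs_cont_onM a b f g : abs_cont_on a b f -> abs_cont_on a b g ->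
  abs_cont_on a b (fun x => f x * g x).
Proof.
move=> acf acg.
have [K K0 fK] := abs_cont_on_bounded acf.
have [M M0 gM] := abs_cont_on_bounded acg.
apply: (@abs_cont_on_lin _ _ f g _ M K) => // x y xab yab.
have -> : f x * g x - f y * g y = (f x - f y) * g x + f y * (g x - g y) by lra.
rewrite (le_trans (ler_normD _ _))// !normrM lerD//.
  by rewrite mulrC ler_wpM2r// gM.
by rewrite ler_wpM2r// fK.
Qed.

Lemma abs_cont_onB a b f g : abs_cont_on a b f -> abs_cont_on a b g ->
  abs_cont_on a b (fun x => f x - g x).
Proof.
move=> acf acg.
apply: (@abs_cont_on_lin _ _ f g _ 1 1) => // x y xab yab; rewrite !mul1r.
have -> : f x - g x - (f y - g y) = (f x - f y) - (g x - g y) by lra.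
exact: ler_normB.
Qed.

Lemma abs_cont_on_id a b : abs_cont_on a b id.
Proof.
move=> e e0; exists e => // n s sS _; 
  rewrite (eq_bigr (fun i => `|(s i).2 - (s i).1|))//.
by move=> i _; rewrite ger0_norm// subr_ge0; have [? []] := sS i.
Qed.

Lemma abs_cont_on_cst a b (k : R) : abs_cont_on a b (fun=> k).
Proof.
by move=> e e0; exists 1 => // n s _ _ _; rewrite big1// => i _; rewrite subrr normr0.
Qed.

Definition partition_itvs (x : R) (P : seq R) : seq (R * R) := zip (x :: P) P.

Lemma sub_itvS a b c d u : a <= c -> d <= b -> sub_itv c d u -> sub_itv a b u.
Proof. by move=> ac db /and3P[cu uu ud]; apply/and3P; split=> //; lra. Qed.

Lemma partition_itvs_sub x (P : seq R) : path <%R x P ->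
  x <= last x P /\ all (sub_itv x (last x P)) (partition_itvs x P).
Proof.
elim: P x => //= y P IH x /andP[xy /IH[ylast yP]].
split; first exact: le_trans (ltW xy) ylast.
rewrite {1}/sub_itv/= lexx (ltW xy) ylast/=.
by apply: sub_all yP => u; apply: sub_itvS; rewrite ?(ltW xy).
Qed.

Lemma partition_itvs_disj x (P : seq R) : path <%R x P ->
  pairwise disj_itv (partition_itvs x P).
Proof.
elim: P x => //= y P IH x /andP[xy yP]; rewrite IH// andbT.
have [_] := partition_itvs_sub yP.
by apply: sub_all => u /and3P[yu _ _]; rewrite /disj_itv/= yu.
Qed.

Lemma partition_itvs_length x (P : seq R) :
  \sum_(u <- partition_itvs x P) (u.2 - u.1) = last x P - x.
Proof.
elim: P x => [|y P IH] x /=; first by rewrite big_nil subrr.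
by rewrite big_cons IH/= addrC subrKA.
Qed.

Lemma partition_itvs_variation x y f (P : seq R) :
  \sum_(u <- partition_itvs x P) `|f u.2 - f u.1| = variation x y f P.
Proof.
elim: P x => [|z P IH] x; first by rewrite /variation !big_nil.
by rewrite big_cons IH/= /variation [RHS]big_nat_recl//=.
Qed.

Let disjs c d s1 s2 : all (sub_itv c d) s1 -> all (disj_itv (c, d)) s2 ->
  allrel disj_itv s1 s2.
Proof.
move=> /allP h1 /allP h2; apply/allrelP => u v /h1/and3P[cu _ ud] /h2.
by rewrite /disj_itv/= => /orP[?|?]; apply/orP; [left|right]; lra.
Qed.

(* Refining the intervals of [L] one at a time avoids choosing near-optimal
   partitions of all of them simultaneously. *)
Lemma sum_total_variation_le a b f d e :
  (forall s, all (sub_itv a b) s -> pairwise disj_itv s ->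
    \sum_(u <- s) (u.2 - u.1) < d -> \sum_(u <- s) `|f u.2 - f u.1| < e) ->
  forall L s, all (sub_itv a b) (s ++ L) -> pairwise disj_itv (s ++ L) ->
    \sum_(u <- s ++ L) (u.2 - u.1) < d ->
    ((\sum_(u <- s) `|f u.2 - f u.1|)%:E +
      \sum_(u <- L) total_variation u.1 u.2 f <= e%:E)%E.
Proof.
move=> H; elim=> [|u L IH] s.
  rewrite cats0 big_nil adde0 lee_fin => sS sd sl; exact/ltW/H.
rewrite all_cat /= => /and3P[sS uS LS].
rewrite pairwise_cat/= allrel_consr => /andP[/andP[su sL]] /and3P[sd uL Ld].
rewrite big_cat big_cons/= => sl.
have /and3P[au uu ub] := uS.
(* Any partition of the first interval can be moved into [s]: it has the same total length and stays
   disjoint from the rest. *)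
have {}IH P : itv_partition u.1 u.2 P ->
    ((\sum_(u <- s) `|f u.2 - f u.1|)%:E + ((variation u.1 u.2 f P)%:E +
      \sum_(u <- L) total_variation u.1 u.2 f) <= e%:E)%E.
  move=> [uP /eqP Pu]; have [_ PS] := partition_itvs_sub uP.
  rewrite Pu in PS.
  have := IH (s ++ partition_itvs u.1 P).
  have -> : \sum_(v <- s ++ partition_itvs u.1 P) `|f v.2 - f v.1| =
      \sum_(v <- s) `|f v.2 - f v.1| + variation u.1 u.2 f P.
    by rewrite big_cat/= (partition_itvs_variation _ u.2).
  rewrite EFinD -addeA; apply.
  - rewrite !all_cat sS LS andbT/=; apply: sub_all PS => v.
    exact: sub_itvS.
  - rewrite pairwise_cat pairwise_cat allrel_catl sL sd Ld partition_itvs_disj//=.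
    have uE : (u.1, u.2) = u by case: (u).
    rewrite andbT (disjs PS) ?uE//= andbT.
    have := @disjs u.1 u.2 (partition_itvs u.1 P) s PS.
    rewrite uE => /(_ _)/allrelP h.
    apply/allrelP => v w vs wP; have := h _ w v wP vs.
    rewrite /disj_itv orbC; apply.
    by apply: sub_all su => z; rewrite /disj_itv orbC.
  - by rewrite !big_cat/= partition_itvs_length Pu -addrA.
set T := (\sum_(u <- L) _)%E in IH *.
have T0 : (0 <= T)%E.
  rewrite /T big_seq; apply: sume_ge0 => v /(allP LS)/and3P[_ vv _].
  exact: total_variation_ge0.
(* One partition suffices to see that the tail [T] is finite, hence can be subtracted; a degenerate
   interval has the empty partition. *)
have [P0 uP0] : exists P, itv_partition u.1 u.2 P.
  move: uu; rewrite le_eqVlt => /orP[/eqP ->|uu].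
    by exists [::].
  by exists [:: u.2]; exact: itv_partition1.
have Tfin : T \is a fin_num.
  rewrite ge0_fin_numE// ltNge leye_eq; apply/negP => /eqP TE.
  by have := IH _ uP0; rewrite TE addey// addey.
rewrite big_cons addeCA -leeBrDr ?fin_numD ?Tfin//.
apply: ge_ereal_sup => _ [_ [P uP <-] <-].
by rewrite leeBrDr ?fin_numD ?Tfin// addeCA; exact: IH.
Qed.

(** On an interval shorter than the modulus for tolerance [1], the variation is at most [1];
    additivity then covers [[a, t]] in finitely many steps. *)
Lemma abs_cont_on_total_variation_fin a b f t : abs_cont_on a b f ->
  a <= t <= b -> total_variation a t f \is a fin_num.
Proof.
move=> acf; have [d d0 H] := abs_cont_on_seq acf ltr01.
have TV1 x y : a <= x -> x <= y -> y <= b -> y - x < d ->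
    (total_variation x y f <= 1%:E)%E.
  move=> ax xy yb yxd; have := @sum_total_variation_le _ _ _ _ _ H [:: (x, y)] [::].
  rewrite !big_nil/= !big_seq1 add0e; apply => //.
  by rewrite /sub_itv/= ax xy yb.
have step n : forall x, a <= x <= b -> x - a <= n%:R * (d / 2) ->
    total_variation a x f \is a fin_num.
  elim: n => [|n IH] x /andP[ax xb].
    rewrite mul0r subr_le0 => xa; have -> : x = a by apply/le_anti; rewrite xa ax.
    by rewrite total_variationxx.
  rewrite -natr1 mulrDl mul1r => xn.
  have n0 : 0 <= n%:R * (d / 2) by rewrite mulr_ge0// divr_ge0// ltW.
  have [xad|xad] := leP (x - a) (d / 2).
    rewrite ge0_fin_numE ?total_variation_ge0//.
    by rewrite (le_lt_trans (TV1 _ _ _ _ _ _))// ?ltry//; lra.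
  rewrite (@total_variationD _ _ _ (x - d / 2)); try lra.
  rewrite fin_numD IH; try lra.
  rewrite ge0_fin_numE ?total_variation_ge0//; last lra.
  by rewrite (le_lt_trans (TV1 _ _ _ _ _ _))// ?ltry//; lra.
have [n Hn] : exists n : nat, b - a <= n%:R * (d / 2).
  exists (Num.truncn ((b - a) / (d / 2))).+1.
  by rewrite -ler_pdivrMr ?divr_gt0// ltW// truncnS_gt.
move=> /andP[ta tb]; apply: (step n); first by rewrite ta.
by apply: (le_trans _ Hn); rewrite lerD2r.
Qed.

(** By additivity, an increment of the variation function is the variation over that interval, and
    [sum_total_variation_le] bounds the sum of these. *)
Lemma total_variation_abs_cont a b f : abs_cont_on a b f ->
  abs_cont_on a b (fun t => fine (total_variation a t f)).
Proof.
(* Half of [e], because passing to suprema over partitions leaves only a non-strict bound. *)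
move=> acf e e0; have e20 : 0 < e / 2 by rewrite divr_gt0.
have [d d0 H] := abs_cont_on_seq acf e20; exists d => // n s sS sd sl.
apply: (@le_lt_trans _ _ (e / 2)); last lra.
rewrite -lee_fin -sumEFin.
have := @sum_total_variation_le _ _ _ _ _ H [seq s i | i <- index_enum 'I_n] [::].
rewrite !cat0s !big_map big_nil add0e => h.
apply: le_trans (h _ _ sl).
- apply: lee_sum => i _; have [ai [ii ib]] := sS i.
  have TVi : total_variation a (s i).2 f =
      (total_variation a (s i).1 f + total_variation (s i).1 (s i).2 f)%E.
    exact: total_variationD.
  have f1 : total_variation a (s i).1 f \is a fin_num.
    by apply: (abs_cont_on_total_variation_fin acf); lra.
  have f2 : total_variation a (s i).2 f \is a fin_num.
    by apply: (abs_cont_on_total_variation_fin acf); lra.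
  have f3 : total_variation (s i).1 (s i).2 f \is a fin_num.
    by move: f2; rewrite TVi fin_numD => /andP[].
  rewrite TVi fineD// [X in `|X|]addrAC subrr add0r ger0_norm ?fineK//.
  exact/fine_ge0/total_variation_ge0.
- apply/allP => _ /mapP[i _ ->]; have [ai [ii ib]] := sS i.
  by rewrite /sub_itv ai ii ib.
- rewrite pairwise_map; apply: (@sub_pairwise _ (fun i j => i != j)).
    by move=> i j ij; apply/orP; exact: sd.
  by rewrite -uniq_pairwise index_enum_uniq.
Qed.

Lemma total_variation_nondecreasing_fine a b f : abs_cont_on a b f ->
  {in `[a, b] &, nondecreasing_fun (fun t => fine (total_variation a t f))}.
Proof.
move=> acf x y xab yab xy.
have ? := @total_variation_nondecreasing _ a b f x y xab yab xy.
by apply: fine_le => //; apply: (abs_cont_on_total_variation_fin acf).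
Qed.

(** The second half of the Jordan decomposition: the variation over [[x, y]] is at least
    [f y - f x]. *)
Lemma total_variationB_nondecreasing a b f : abs_cont_on a b f ->
  {in `[a, b] &, nondecreasing_fun (fun t => fine (total_variation a t f) - f t)}.
Proof.
move=> acf x y; rewrite !in_itv/= => xab yab xy.
have fx := abs_cont_on_total_variation_fin acf xab.
have fy := abs_cont_on_total_variation_fin acf yab.
have /andP[ax xb] := xab.
have TVE := @total_variationD _ _ _ _ f ax xy.
have fxy : total_variation x y f \is a fin_num.
  by move: fy; rewrite TVE fin_numD => /andP[].
have := total_variation_ge f xy; rewrite -(fineK fxy) lee_fin => h.
rewrite TVE fineD//; have := ler_norm (f y - f x); lra.
Qed.

End absolute_continuity.

(** * Densities of monotone absolutely continuous functions *)

Section monotone_density.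
Context {R : realType}.
Local Notation mu := (@lebesgue_measure R).

Lemma lebesgue_stieltjes_measure_itvoc (F : cumulative R R) (l r : R) : l <= r ->
  lebesgue_stieltjes_measure F `]l, r]%classic = (F r - F l)%:E.
Proof.
move=> lr; rewrite /lebesgue_stieltjes_measure/= /measure_extension/=.
by rewrite measurable_mu_extE/= ?wlength_itv_bnd//; exact: is_ocitv.
Qed.

(** Finite measure excludes unbounded intervals, and openness excludes the left endpoint. The inner
    interval serves to bound Lebesgue measure from below, the outer one to bound Stieltjes measure
    from above. *)
Lemma open_itv_bounds (I : set R) : open I -> is_interval I -> (mu I < +oo)%E ->
  I = set0 \/ exists l r : R, [/\ l < r, `]l, r[%classic `<=` I & I `<=` `]l, r]%classic].
Proof.
move=> oI iI Ifin; have IE : [set` Rhull I] = I by rewrite RhullK// inE.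
have [->|/set0P I0] := eqVneq I set0; [by left|right].
have Iball x : I x -> exists2 e : R, 0 < e & I (x - e) /\ I (x + e).
  move=> Ix; have /nbhs_ballP[e /= e0 eI] : nbhs x I by exact: open_nbhs_nbhs.
  have e2 : 0 < e / 2 by rewrite divr_gt0.
  exists (e / 2) => //; split; apply: eI; rewrite /ball/=.
    by rewrite opprB addrCA subrr addr0 gtr0_norm//; lra.
  by rewrite opprD addrA subrr add0r normrN gtr0_norm//; lra.
have [bl [br [l [r IlrE]]]] : exists (bl br : bool) (l r : R),
    I = [set` Interval (BSide bl l) (BSide br r)].
  move: Ifin; rewrite -IE lebesgue_measure_itv.
  case: (Rhull I) IE => -[bl l|[|]] [br r|[|]] IE /=;
    try (by rewrite ?ltry ?ltNyr//);
    try (by exists bl, br, l, r); have [x] := I0; rewrite -IE/= in_itv/= ?andbF//.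
exists l, r.
have Isub x : I x -> l <= x <= r.
  rewrite IlrE/= in_itv/= => /andP[lx xr].
  by case: bl lx {IlrE} => /= lx; case: br xr => /= xr; lra.
split.
- have [x /Iball[e e0 [/Isub ? /Isub ?]]] := I0; lra.
- move=> x; rewrite IlrE/= !in_itv/= => /andP[lx xr].
  by case: bl {IlrE} => /=; case: br => /=; lra.
- move=> x Ix; have := Isub _ Ix => /andP[_ xr]; rewrite /= in_itv/= xr andbT.
  have [e e0 [/Isub ? _]] := Iball _ Ix; lra.
Qed.

(** For [a <= b], the projection onto [[a, b]]; composing with it extends a function by constants to
    the whole line, as [cumulative] requires. *)
Let clamp (a b x : R) := Num.max a (Num.min x b).

Let clamp_itv a b x : a <= b -> a <= clamp a b x <= b.
Proof. by move=> ab; rewrite /clamp le_max lexx/= ge_max ab ge_min lexx orbT. Qed.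

Let clamp_id a b x : a <= x <= b -> clamp a b x = x.
Proof. by move=> /andP[ax xb]; rewrite /clamp (min_idPl xb) (max_idPr ax). Qed.

Let clamp_le a b x y : x <= y -> clamp a b x <= clamp a b y.
Proof.
move=> xy; rewrite /clamp ge_max !le_max lexx/=; apply/orP; right.
by rewrite le_min !ge_min xy lexx orbT.
Qed.

Let clamp_dist a b x y : x <= y -> clamp a b y - clamp a b x <= y - x.
Proof. move=> xy; rewrite /clamp; case: (leP x b) => ?; case: (leP y b) => ?;
by case: (leP a x) => ?; case: (leP a y) => ?; case: (leP a b) => ?; lra. Qed.

Section dominates.
Variables (a b : R) (G : R -> R) (F : cumulative R R).
Hypotheses (ab : a <= b) (acG : abs_cont_on a b G).
Hypothesis FG : forall x, F x = G (clamp a b x).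

(** An open set is a countable disjoint union of open intervals. Clamping does not lengthen them, so
    absolute continuity bounds every finite partial sum of their Stieltjes measures. *)
Lemma lebesgue_stieltjes_abs_cont_open (e : R) : 0 < e ->
  exists2 d : R, 0 < d & forall U, open U -> (mu U < d%:E)%E ->
    (lebesgue_stieltjes_measure F U <= e%:E)%E.
Proof.
move=> e0; have [d d0 H] := acG e0; exists d => // U oU Ud.
set I := open_disjoint_itv oU.
have mI k : measurable (I k : set (measurableTypeR R)).
  by apply: open_measurable; exact: open_disjoint_itv_open.
have tI : trivIset setT I  by exact: open_disjoint_itv_trivIset.
have UI : U = \bigcup_k I k  by exact: open_disjoint_itv_bigcup.
have mUI : measurable (\bigcup_k I k : set (measurableTypeR R)).
  exact: bigcupT_measurable.
have Ifin k : (mu (I k) < +oo)%E.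
  apply: (le_lt_trans _ (lt_trans Ud (ltry d))).
  by apply: le_measure; rewrite ?inE//; [rewrite UI|rewrite UI; exact: bigcup_sup].
(* An empty component is represented by the degenerate interval [(a, a)]. *)
have /choice[J JP] k : exists u : R * R,
   [/\ (u.1 = a /\ u.2 = a) \/ u.1 < u.2, `]u.1, u.2[%classic `<=` I k
     & I k `<=` `]u.1, u.2]%classic].
  have oIk : open (I k) by exact: open_disjoint_itv_open.
  have iIk : is_interval (I k) by exact: open_disjoint_itv_is_interval.
  have [->|[l [r [lr h1 h2]]]] := open_itv_bounds oIk iIk (Ifin k).
    exists (a, a); split => /=; [by left| |by []].
    by move=> x /=; rewrite in_itv/=; lra.
  by exists (l, r); split => //; right.
have Jle k : (J k).1 <= (J k).2 by have [[[-> ->]|/ltW]] := JP k.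
rewrite UI measure_semi_bigcup//.
apply: lime_le; first exact: is_cvg_nneseries.
apply: nearW => n; rewrite big_mkord.
pose s (i : 'I_n) := (clamp a b (J i).1, clamp a b (J i).2).
apply: (@le_trans _ _ (\sum_(i < n) `|G (s i).2 - G (s i).1|%:E)%E).
  apply: lee_sum => i _; have [_ _ IJ] := JP i.
  apply: (@le_trans _ _ (lebesgue_stieltjes_measure F `](J i).1, (J i).2]%classic)).
    by apply: le_measure; rewrite ?inE//; exact: measurable_itv.
  by rewrite lebesgue_stieltjes_measure_itvoc// lee_fin !FG ler_norm.
rewrite sumEFin lee_fin ltW//; apply: (H n s).
- move=> i; have /andP[? ?] := clamp_itv (J i).1 ab.
  have /andP[? ?] := clamp_itv (J i).2 ab.
  by rewrite /s/=; split=> //; split => //; exact: clamp_le.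
- move=> i j ij; rewrite /s/=.
  have ca : clamp a b a = a by rewrite clamp_id// lexx.
  have [[[-> ->]|Ji] iI _] := JP i.
    by left; rewrite ca; have /andP[] := clamp_itv (J j).1 ab.
  have [[[-> ->]|Jj] jI _] := JP j.
    by right; rewrite ca; have /andP[] := clamp_itv (J i).1 ab.
  have [h|h] := leP (J i).2 (J j).1; first by left; exact: clamp_le.
  have [h'|h'] := leP (J j).2 (J i).1; first by right; exact: clamp_le.
  (* If two intervals overlapped, the midpoint of the overlap would lie in both [I i] and [I j]. *)
  exfalso; pose l := Num.max (J i).1 (J j).1; pose r := Num.min (J i).2 (J j).2.
  have lr : l < r by rewrite /l /r gt_max !lt_min Ji Jj h h'.
  have : (I i `&` I j) ((l + r) / 2).
    have [lx xr] : l < (l + r) / 2 /\ (l + r) / 2 < r by split; lra.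
    move: lx xr; rewrite {1}/l {2}/r gt_max lt_min => /andP[? ?] /andP[? ?].
    by split; [apply: iI|apply: jI]; rewrite /= in_itv/=; apply/andP; split.
  move/trivIsetP : tI => /(_ _ _ Logic.I Logic.I ij) -> [].
- rewrite -lte_fin -sumEFin.
  apply: (le_lt_trans _ Ud).
  apply: (@le_trans _ _ (\sum_(i < n) mu (I i))%E).
    apply: lee_sum => i _; have [_ JI _] := JP i.
    apply: (@le_trans _ _ (mu `](J i).1, (J i).2[%classic)).
      rewrite lebesgue_measure_itv/= lte_fin; case: ifPn => h.
        by rewrite -EFinB lee_fin; exact: clamp_dist.
      rewrite lee_fin subr_le0; apply: clamp_le; rewrite leNgt//.
    by apply: le_measure; rewrite ?inE//; exact: measurable_itv.
  rewrite UI measure_semi_bigcup// -(big_mkord xpredT (fun i => mu (I i))).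
  exact: nneseries_lim_ge.
Qed.

(** Outer regularity encloses a Lebesgue null set in an open set of arbitrarily small measure. *)
Lemma lebesgue_stieltjes_dominated : lebesgue_stieltjes_measure F `<< mu.
Proof.
apply/null_content_dominatesP => N mN N0; apply/eqP; rewrite eq_le measure_ge0 andbT.
apply/lee_addgt0Pr => e e0; rewrite add0e.
have [d d0 H] := lebesgue_stieltjes_abs_cont_open e0.
have [|U [oU NU Ud]] := lebesgue_regularity_outer mN _ d0; first by rewrite N0.
have mU := open_measurable oU.
apply: (@le_trans _ _ (lebesgue_stieltjes_measure F U)).
  by apply: le_measure; rewrite ?inE.
apply: H => //; rewrite -(setDUK NU).
rewrite measureU//; [|exact: measurableD|by rewrite setDIK].
by rewrite N0 add0e.
Qed.

End dominates.

Lemma abs_cont_clamp_continuous a b (G : R -> R) : a <= b ->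
  abs_cont_on a b G -> continuous (fun x => G (clamp a b x)).
Proof.
move=> ab acG x; apply/cvgrPdist_lt => e e0.
have [d d0 H] := abs_cont_on_dist acG e0.
near=> y; apply: H; [exact: clamp_itv..|].
have : `|x - y| < d by near: y; exact: cvgr_dist_lt.
apply: le_lt_trans; have [xy|/ltW yx] := leP x y.
  by rewrite distrC (distrC x) !ger0_norm ?subr_ge0//; [exact: clamp_dist|exact: clamp_le].
by rewrite !ger0_norm ?subr_ge0//; [exact: clamp_dist|exact: clamp_le].
Unshelve. all: by end_near. Qed.

Lemma abs_cont_measurable a b (G : R -> R) : a <= b ->
  abs_cont_on a b G -> measurable_fun `[a, b]%classic G.
Proof.
move=> ab acG.
apply: (@eq_measurable_fun _ _ _ _ _ (fun x => G (clamp a b x))).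
  by move=> x; rewrite inE/= in_itv/= => /clamp_id ->.
apply: measurable_funTS; apply: continuous_measurable_fun.
exact: abs_cont_clamp_continuous.
Qed.

Lemma nondecreasing_abs_cont_density a b (G : R -> R) : a <= b ->
  abs_cont_on a b G -> {in `[a, b] &, nondecreasing_fun G} ->
  exists g, weak_deriv_on a b G g.
Proof.
move=> ab acG ndG; pose Gt x := G (clamp a b x).
have ndGt : nondecreasing Gt.
  move=> x y xy; apply: ndG; rewrite ?in_itv ?clamp_itv//; exact: clamp_le.
have cGt : continuous Gt := abs_cont_clamp_continuous ab acG.
pose F : cumulative R R := HB.pack Gt
  (isCumulative.Build R _ R Gt ndGt (right_continuousW cGt)).
(* Restricting to []a, b]] makes the Stieltjes measure finite, as Radon-Nikodym is applied to a
   finite measure. *)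
have mD : measurable (`]a, b]%classic : set (measurableTypeR R)) by exact: measurable_itv.
have Dfin : (lebesgue_stieltjes_measure F `]a, b]%classic < +oo)%E.
  by rewrite lebesgue_stieltjes_measure_itvoc ?ltry.
pose nu : {finite_measure set (measurableTypeR R) -> \bar R} := mfrestr mD Dfin.
have dom : nu `<< mu.
  apply/null_content_dominatesP => N mN N0; apply/eqP; rewrite eq_le measure_ge0 andbT.
  have /null_content_dominatesP := @lebesgue_stieltjes_dominated a b G F ab acG (fun=> erefl).
  move=> /(_ N mN N0) <-; rewrite /nu/= /mfrestr /mrestr.
  by apply: le_measure; rewrite ?inE//; exact: measurableI.
have [g [g0 gfin gint gE]] := radon_nikodym_sigma_finite dom.
exists (fine \o g).
have fg : EFin \o (fine \o g) = g by apply/funext => x /=; rewrite fineK.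
split.
  rewrite fg; apply: integrableS gint => //; exact: measurable_itv.
move=> t; rewrite in_itv/= => /andP[at_ tb].
under eq_integral do rewrite fineK//.
rewrite -gE; last exact: measurable_itv.
rewrite /nu/= /mfrestr /mrestr.
(* The restriction drops the point [a], leaving a half-open interval whose mass is the increment of
   [G]. *)
have -> : `[a, t]%classic `&` `]a, b]%classic = `]a, t]%classic.
  by apply/seteqP; split=> x /=; rewrite !in_itv/=; [move=> [? ?]|split]; lra.
rewrite lebesgue_stieltjes_measure_itvoc//= /Gt !clamp_id ?lexx ?at_ ?ab//.
by rewrite -EFinD subrKC.
Qed.

End monotone_density.

(** * Monotonicity and conjunction of almost-everywhere statements *)

Section ae_lemmas.
Context d (T : measurableType d) (R : realType) (nu : {measure set T -> \bar R}).

Lemma aeS (P Q : T -> Prop) : (forall t, P t -> Q t) ->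
  {ae nu, forall t, P t} -> {ae nu, forall t, Q t}.
Proof. by move=> PQ; exact: (@filterS _ _ (ae_filter_ringOfSetsType nu) P Q PQ). Qed.

Lemma aeI (P Q : T -> Prop) : {ae nu, forall t, P t} -> {ae nu, forall t, Q t} ->
  {ae nu, forall t, P t /\ Q t}.
Proof. by move=> hP hQ; exact: (@filterI _ _ (ae_filter_ringOfSetsType nu) P Q hP hQ). Qed.

End ae_lemmas.

(** * The fundamental theorem of calculus for absolutely continuous functions *)

Section abs_cont_FTC.
Context {R : realType}.
Local Notation mu := (@lebesgue_measure R).

(** Write [f] as [V - (V - f)] with [V] the variation function; both terms are nondecreasing and
    absolutely continuous, and their densities subtract. *)
Lemma abs_cont_density a b (f : R -> R) : a <= b -> abs_cont_on a b f ->
  exists g, weak_deriv_on a b f g.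
Proof.
move=> ab acf; pose V t := fine (total_variation a t f).
have acV := total_variation_abs_cont acf.
have [g1 [ig1 Vg1]] := nondecreasing_abs_cont_density ab acV
  (total_variation_nondecreasing_fine acf).
have [g2 [ig2 Vg2]] := nondecreasing_abs_cont_density ab (abs_cont_onB acV acf)
  (total_variationB_nondecreasing acf).
have mab : measurable (`[a, b]%classic : set (measurableTypeR R)) by exact: measurable_itv.
exists (fun t => g1 t - g2 t); split.
  by apply: eq_integrable (integrableB mab ig1 ig2).
move=> t tab; have mt : measurable (`[a, t]%classic : set (measurableTypeR R)) by exact: measurable_itv.
have sub : `[a, t]%classic `<=` `[a, b]%classic.
  by move: tab; rewrite in_itv/= => /andP[_ tb] x /=; rewrite !in_itv/=; lra.
have ig1t := integrableS mab mt sub ig1.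
have ig2t := integrableS mab mt sub ig2.
under eq_integral do rewrite EFinB.
rewrite integralB_EFin//.
have := Vg1 _ tab; have := Vg2 _ tab.
have := integrable_fin_num mt ig1t; have := integrable_fin_num mt ig2t.
rewrite /=; move: (\int[mu]_(_ in _) _)%E => [r2| |]//; move: (\int[mu]_(_ in _) _)%E => [r1| |]// _ _.
rewrite -!EFinD => -[h2] [h1].
by congr EFin; move: h1 h2; rewrite /V; lra.
Qed.

Lemma ae_neq (c : R) : {ae mu, forall t, t != c}.
Proof.
exists [set c]; split; [exact: measurable_set1|exact: lebesgue_measure_set1|].
by move=> x /= /negP; rewrite negbK => /eqP.
Qed.

Lemma weak_deriv_ae_is_derive a b (f g : R -> R) : weak_deriv_on a b f g ->
  {ae mu, forall t, a < t < b -> is_derive t 1 f (g t)}.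
Proof.
move=> [ig fg].
have mab : measurable (`[a, b]%classic : set (measurableTypeR R)) by exact: measurable_itv.
(* Extending [g] by [0] makes it locally integrable on the line, as Lebesgue differentiation in
   [FTC1] asks; near an interior point nothing changes. *)
have := integrable_locally_restrict mab ig; set h := g \_ _ => lh.
have ih y : mu.-integrable [set` Interval (BLeft a) (BRight y)] (EFin \o h).
  rewrite /h -restrict_EFin; apply: integrableS ((integrable_mkcond _ mab).1 ig) => //.
have := FTC1 ih lh; apply: aeS => t H /andP[at_ tb].
have [|dF Fh] := H; first by rewrite /= lte_fin.
have -> : g t = h t.
  by rewrite /h patchE mem_set//= in_itv/= !ltW.
pose F y := f a + (\int[mu]_(t in `[a, y]) h t)%R.
apply: (@near_eq_is_derive _ _ _ F).
  near=> y.
  have yab : y \in `[a, b].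
    apply: subset_itv_oo_cc; near: y.
    by apply: near_in_itvoo; rewrite in_itv/= at_.
  apply: EFin_inj; rewrite (fg _ yab) /F EFinD; congr (_ + _)%E.
  rewrite /Rintegral fineK.
    apply: eq_integral => x; rewrite inE/= in_itv/= => /andP[ax xy].
    rewrite /h patchE mem_set//= in_itv/= ax/= (le_trans xy)//.
    by move: yab; rewrite in_itv/= => /andP[].
  by apply: integrable_fin_num (ih y); exact: measurable_itv.
rewrite /F -[h t]add0r; apply: is_deriveD; apply: DeriveDef => //.
by rewrite -derive1E.
Unshelve. all: by end_near. Qed.

Lemma abs_cont_ae_derivable a b (f : R -> R) : a <= b -> abs_cont_on a b f ->
  {ae mu, forall t, a < t < b -> derivable f t 1}.
Proof.
move=> ab /(abs_cont_density ab)[g /weak_deriv_ae_is_derive].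
by apply: aeS => t H /H[].
Qed.

(** The derivative enters through any measurable [h] agreeing with it almost everywhere, so that a
    jointly measurable version can be integrated; [h] then equals the density almost everywhere. *)
Lemma abs_cont_FTC a b (f h : R -> R) : a <= b -> abs_cont_on a b f ->
  measurable_fun `[a, b]%classic h ->
  {ae mu, forall t, a < t < b -> derivable f t 1 -> h t = derive1 f t} ->
  mu.-integrable `[a, b]%classic (EFin \o h) /\
  (\int[mu]_(t in `[a, b]%classic) (h t)%:E = (f b - f a)%:E)%E.
Proof.
move=> ab acf mh hf; have [g gP] := abs_cont_density ab acf.
have [ig fg] := gP.
have mab : measurable (`[a, b]%classic : set (measurableTypeR R)) by exact: measurable_itv.
have gh : ae_eq mu `[a, b]%classic (EFin \o g) (EFin \o h).
  have := aeI (weak_deriv_ae_is_derive gP) (aeI hf (aeI (ae_neq a) (ae_neq b))).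
  apply: aeS => t [H1 [H2 [ta tb]]] /=; rewrite in_itv/= => /andP[at_ bt].
  have tab : a < t < b by rewrite !lt_neqAle at_ bt tb eq_sym ta.
  have [df fgt] := H1 tab.
  by rewrite H2// derive1E fgt.
have mEh : measurable_fun `[a, b]%classic (EFin \o h) by exact/measurable_EFinP.
have mEg : measurable_fun `[a, b]%classic (EFin \o g) := measurable_int _ ig.
have <- : (\int[mu]_(t in `[a, b]%classic) (g t)%:E = (f b - f a)%:E)%E.
  have := fg b; rewrite in_itv/= lexx ab => /(_ erefl).
  have := integrable_fin_num mab ig.
  rewrite /=; move: (\int[mu]_(_ in _) _)%E => [r| |]// _.
  by rewrite -EFinD => -[->]; rewrite addrAC subrr add0r.
split; last by apply: ae_eq_integral => //; exact: (@ae_eq_sym _ _ _ _ _ _ _ _ gh).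
apply/integrableP; split => //.
have /integrableP[_] := ig; apply: le_lt_trans.
rewrite le_eqVlt; apply/orP; left; apply/eqP.
apply: ae_eq_integral => //; [exact: measurableT_comp..|].
by apply: aeS gh => t H /H /= [->].
Qed.

End abs_cont_FTC.

(** * A jointly measurable version of the derivative *)

Section measurable_derivative.
Context {R : realType} d (X : measurableType d).
Local Notation Y := (measurableTypeR R).
Variable p : X -> R -> R.

(** A limit superior along the steps [1 / (n + 1)]: countably many operations keep joint
    measurability, and [fine] sends infinite values to [0]. *)
Definition mderiv (x : X) (t : R) : R :=
  fine (limn_esup (fun n => (n.+1%:R * (p x (t + n.+1%:R^-1) - p x t))%:E)).

(* On absolutely continuous sections this is exactly the set of points of
   differentiability, but described by countably many conditions. *)
Definition rat_derivable : set (X * Y) :=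
  \bigcap_(k in [set: nat]) \bigcup_(n in [set: nat]) \bigcap_(q in [set: rat])
  [set z | `|ratr q : R| < n.+1%:R^-1 ->
    `|p z.1 (z.2 + ratr q) - p z.1 z.2 - ratr q * mderiv z.1 z.2| <=
    `|ratr q| * k.+1%:R^-1].

Hypothesis mp : measurable_fun [set: X * Y] (fun z => p z.1 z.2).

Lemma measurable_shift (h : R) :
  measurable_fun [set: X * Y] (fun z => p z.1 (z.2 + h)).
Proof.
have msnd : measurable_fun [set: X * Y] (fun z => z.2 + h : R).
  exact: measurable_funD.
have := @measurable_fun_pair _ _ _ _ _ _ (fst : X * Y -> X) (fun z : X * Y => z.2 + h : Y)
   measurable_fst msnd.
by move=> /(measurableT_comp mp).
Qed.

Lemma measurable_mderiv : measurable_fun [set: X * Y] (fun z => mderiv z.1 z.2).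
Proof.
apply: (measurableT_comp (@fine_measurable R setT measurableT)).
apply: measurable_fun_limn_esup => n; apply/measurable_EFinP.
apply: measurable_funM => //; apply: measurable_funB => //.
exact: measurable_shift.
Qed.

Lemma measurable_rat_derivable : measurable rat_derivable.
Proof.
apply: bigcapT_measurable => k; apply: bigcupT_measurable => n.
have mQ (q : rat) : measurable [set z : X * Y | `|ratr q : R| < n.+1%:R^-1 ->
    `|p z.1 (z.2 + ratr q) - p z.1 z.2 - ratr q * mderiv z.1 z.2| <=
    `|ratr q| * k.+1%:R^-1].
  have [qn|qn] := boolP (`|ratr q : R| < n.+1%:R^-1); last first.
    rewrite (_ : [set _ | _] = setT)//; by apply/seteqP; split.
  rewrite (_ : [set _ | _] = [set: X * Y] `&` [set z |
    (`|p z.1 (z.2 + ratr q) - p z.1 z.2 - ratr q * mderiv z.1 z.2| <=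
    `|ratr q| * k.+1%:R^-1)]); last first.
    by rewrite setTI; apply/seteqP; split=> z /=; [exact|].
  apply: measurable_fun_le => //.
  apply: measurableT_comp => //; apply: measurable_funB.
    by apply: measurable_funB => //; exact: measurable_shift.
  by apply: measurable_funM => //; exact: measurable_mderiv.
rewrite -[X in measurable X]setCK setC_bigcap; apply: measurableC.
by apply: bigcupT_measurable_rat => q; exact: measurableC.
Qed.

(** The first-order estimate without division, in the shape of [rat_derivable]; it holds trivially
    at [h = 0]. *)
Lemma is_deriveP (f : R -> R) (t D : R) : is_derive t 1 f D <->
  forall e : R, 0 < e -> exists2 r : R, 0 < r & forall h, `|h| < r ->
    `|f (t + h) - f t - h * D| <= `|h| * e.
Proof.
split=> [[df fD] e e0|H].
  have : h^-1 *: (f (h *: 1 + t) - f t) @[h --> 0^'] --> D.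
    by rewrite -fD; exact: df.
  move=> /cvgrPdist_le/(_ _ e0)[/= r r0 Hr]; exists r => // h hr.
  have [->|h0] := eqVneq h 0.
    by rewrite addr0 subrr mul0r subr0 normr0 mul0r.
  have := Hr h; rewrite /= sub0r normrN => /(_ hr h0).
  rewrite /GRing.scale/= mulr1 (addrC h) distrC => Hh.
  have -> : f (t + h) - f t - h * D = h * (h^-1 * (f (t + h) - f t) - D).
    by rewrite mulrBr mulrA divff// mul1r.
  by rewrite normrM ler_wpM2l.
have cvgD : h^-1 *: (f (h *: 1 + t) - f t) @[h --> 0^'] --> D.
  apply/cvgrPdist_le => e e0; have [r r0 Hr] := H _ e0.
  exists r => // h /=; rewrite sub0r normrN => hr h0.
  rewrite /GRing.scale/= mulr1 (addrC h) distrC.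
  have -> : h^-1 * (f (t + h) - f t) - D = h^-1 * (f (t + h) - f t - h * D).
    by rewrite [RHS]mulrBr mulrA mulVf// mul1r.
  by rewrite normrM normfV ler_pdivrMl ?normr_gt0//; exact: Hr.
apply: DeriveDef; first by apply/cvg_ex; exists D.
exact: cvg_lim cvgD.
Qed.

Lemma natSinv_lt (e : R) : 0 < e -> exists n : nat, n.+1%:R^-1 < e.
Proof.
move=> e0; have [n _ Hn] := near_infty_natSinv_lt (PosNum e0).
by exists n; exact: (Hn n (leqnn n)).
Qed.

Lemma is_derive_rat_derivable (x : X) (t D : R) : is_derive t 1 (p x) D ->
  mderiv x t = D /\ rat_derivable (x, t).
Proof.
move=> /is_deriveP H.
have DE : mderiv x t = D.
  (* The estimate at [h = 1 / (n + 1)] shows that the difference quotients converge, so their limit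
     superior is [D]. *)
  rewrite /mderiv; suff /cvg_limn_einf_sup[_ ->] :
    (n.+1%:R * (p x (t + n.+1%:R^-1) - p x t))%:E @[n --> \oo] --> D%:E by [].
  apply: cvg_EFin; first exact: nearW.
  apply/cvgrPdist_le => e e0; have [r r0 Hr] := H _ e0.
  near=> n; have n0 : n.+1%:R != 0 :> R by [].
  have := Hr n.+1%:R^-1; rewrite gtr0_norm ?invr_gt0//.
  have -> : n.+1%:R^-1 < r.
    by near: n; have := near_infty_natSinv_lt (PosNum r0).
  move=> /(_ erefl); rewrite ler_pdivlMl// => Hn /=; apply: le_trans Hn.
  rewrite -[X in X * `|_|](gtr0_norm (ltr0Sn R n)) -normrM distrC.
  by rewrite [in leRHS]mulrBr mulVKf.
split=> // k _; have [r r0 Hr] := H k.+1%:R^-1 (ltac:(by rewrite invr_gt0)).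
have [n nr] := natSinv_lt r0.
by exists n => // q _ /= qn; rewrite DE; apply: Hr; exact: lt_trans nr.
Unshelve. all: by end_near. Qed.

Lemma abs_cont_continuous (a b t : R) (f : R -> R) : abs_cont_on a b f ->
  a < t < b -> {for t, continuous f}.
Proof.
move=> acf tab; apply/cvgrPdist_lt => e e0.
have [r r0 H] := abs_cont_on_dist acf e0.
have tnear : \forall y \near t, y \in `]a, b[.
  by apply: near_in_itvoo; rewrite in_itv/=.
near=> y; apply: H.
- by case/andP: tab => /ltW -> /ltW ->.
- have : y \in `]a, b[ by near: y; exact: tnear.
  by rewrite in_itv/= => /andP[/ltW -> /ltW ->].
- by near: y; exact: cvgr_dist_lt.
Unshelve. all: by end_near. Qed.

(** Violating the estimate is an open condition on [h], because [p x] is continuous; a violation at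
    a real [h] would give one at a nearby rational. *)
Lemma rat_derivable_is_derive (a b t : R) (x : X) : abs_cont_on a b (p x) ->
  a < t < b -> rat_derivable (x, t) -> is_derive t 1 (p x) (mderiv x t).
Proof.
move=> acp /andP[at_ tb] Gxt; apply/is_deriveP => e e0.
have [k ke] := natSinv_lt e0.
have [n _ Hn] := Gxt k Logic.I.
(* The last two bounds keep [t + h] inside []a, b[], where [p x] is continuous. *)
exists (Num.min n.+1%:R^-1 (Num.min (t - a) (b - t))).
  by rewrite !lt_min invr_gt0 ltr0Sn !subr_gt0 at_.
move=> h; rewrite !lt_min => /and3P[hn ha hb].
apply: (@le_trans _ _ (`|h| * k.+1%:R^-1)); last by rewrite ler_wpM2l// ltW.
rewrite leNgt; apply/negP => hlt.
have cp : {for h, continuous (fun y : R => p x (t + y))}.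
  apply: continuous_comp; first exact: (cvgD (cvg_cst _) cvg_id).
  apply: abs_cont_continuous acp _.
  by move: ha hb; rewrite !ltr_norml => /andP[? ?] /andP[? ?]; lra.
have clhs : {for h, continuous (fun y : R =>
    `|p x (t + y) - p x t - y * mderiv x t| - `|y| * k.+1%:R^-1)}.
  apply: cvgB.
    apply: cvg_norm; apply: cvgB; first by apply: cvgB => //; exact: cvg_cst.
    exact: cvgMl cvg_id.
  by apply: cvgMl; apply: cvg_norm; exact: cvg_id.
have : \forall y \near h,
    0 < `|p x (t + y) - p x t - y * mderiv x t| - `|y| * k.+1%:R^-1.
  by apply: (cvgr_gt _ clhs); rewrite subr_gt0.
have : \forall y \near h, `|y| < n.+1%:R^-1.
  have cn : {for h, continuous (fun y : R => `|y|)} by apply: cvg_norm; exact: cvg_id.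
  by apply: (cvgr_lt _ cn).
move=> h1 h2.
have /nbhs_ballP[r /= r0 Hr] : \forall y \near h, `|y| < n.+1%:R^-1 /\
    0 < `|p x (t + y) - p x t - y * mderiv x t| - `|y| * k.+1%:R^-1.
  by near=> y; split; near: y.
have /rat_in_itvoo[q] : h - r < h + r by lra.
rewrite in_itv/= => qh.
have [q1 q2] := Hr (ratr q) (ltac:(by rewrite /ball/= ltr_norml; lra)).
by have := Hn q Logic.I q1; rewrite leNgt -subr_gt0 q2.
Unshelve. all: by end_near. Qed.

End measurable_derivative.

(** * Comparison of integrals and a weighted Hoelder inequality *)

Section measure_lemmas.
Context d (T : measurableType d) (R : realType).
Variable mu : {measure set T -> \bar R}.
Local Open Scope ereal_scope.

(* The larger function need not be measurable: its integral is then a supremum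
   over the simple functions below it. *)
Lemma ae_ge0_le_integral_nonmeasurable (D : set T) (f g : T -> \bar R) :
  measurable D -> measurable_fun D f ->
  (forall x, D x -> 0 <= f x) -> (forall x, D x -> 0 <= g x) ->
  {ae mu, forall x, D x -> f x <= g x} ->
  \int[mu]_(x in D) f x <= \int[mu]_(x in D) g x.
Proof.
move=> mD mf f0 g0 [N [mN N0 fgN]].
(* Removing the null set, where measurability of [f] enters, makes the inequality pointwise, so
   simple functions below the restricted [f] are below [g]. *)
rewrite (ge0_negligible_integral mN mD mf f0 N0) setDE integral_mkcondr.
rewrite !ge0_integralE//; last first.
  by move=> x Dx; rewrite patchE; case: ifPn => // _; exact: f0.
apply: ereal_sup_le => _ [h /= hf <-]; exists h => //= x.
apply: (le_trans (hf x)); rewrite /= !patchE; case: ifPn => // /set_mem Dx.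
case: ifPn => [|_]; last exact: g0.
rewrite inE => /= Nx; apply: contrapT => fg; apply: Nx; apply: fgN => /=.
by move=> /(_ Dx).
Qed.

(** Hoelder's inequality for [u * r^(1/q)] and [w * r^(1/p)]; the two powers of the weight multiply
    to [r]. *)
Lemma weighted_hoelder (u w r : T -> R) (p q : R) :
  measurable_fun setT u -> measurable_fun setT w -> measurable_fun setT r ->
  (forall x, (0 <= r x)%R) -> (0 < p)%R -> (0 < q)%R -> (p^-1 + q^-1 = 1)%R ->
  \int[mu]_x `|(u x * r x * w x)%:E| <=
  (\int[mu]_x (`|u x| `^ q * r x)%:E) `^ q^-1 *
  (\int[mu]_x (`|w x| `^ p * r x)%:E) `^ p^-1.
Proof.
move=> mu_ mw mr r0 p0 q0 pq.
pose f x := (u x * r x `^ q^-1)%R; pose g x := (w x * r x `^ p^-1)%R.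
have mpow s : measurable_fun setT (fun x => r x `^ s)%R.
  exact: (measurableT_comp (measurable_powR s) mr).
have mf : measurable_fun setT f by exact: measurable_funM.
have mg : measurable_fun setT g by exact: measurable_funM.
have qp : (q^-1 + p^-1 = 1)%R by rewrite addrC.
have := hoelder mu mf mg q0 p0 qp.
rewrite Lnorm1 unlock /=.
have E1 : \int[mu]_x `|(f \* g)%R x|%:E = \int[mu]_x `|(u x * r x * w x)%:E|.
  apply: eq_integral => x _; rewrite /= /f /g; congr (`|_|%:E)%R.
  rewrite mulrACA -powRD ?qp ?powRr1 ?oner_eq0//.
  by rewrite mulrAC.
have powE (v : T -> R) (s : R) x : (0 < s)%R ->
    (`|v x * r x `^ s^-1| `^ s)%R = (`|v x| `^ s * r x)%R.
  move=> s0; rewrite normrM powRM// (ger0_norm (powR_ge0 _ _)) -powRrM mulVf ?gt_eqF//.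
  by rewrite powRr1.
have Ef : \int[mu]_x (`|f x| `^ q)%:E = \int[mu]_x (`|u x| `^ q * r x)%:E.
  by apply: eq_integral => x _; rewrite /f powE.
have Eg : \int[mu]_x (`|g x| `^ p)%:E = \int[mu]_x (`|w x| `^ p * r x)%:E.
  by apply: eq_integral => x _; rewrite /g powE.
by rewrite /= in E1 *; rewrite E1 Ef Eg.
Qed.

End measure_lemmas.

(** * Null sections of a set in a product *)

Section null_sections.
Context d1 d2 (T1 : measurableType d1) (T2 : measurableType d2) (R : realType).
Variables (m1 : {sigma_finite_measure set T1 -> \bar R})
  (m2 : {sigma_finite_measure set T2 -> \bar R}).
Local Open Scope ereal_scope.

(** Integrating the measures of the sections in either order gives the same product measure, and a
    nonnegative function with integral [0] vanishes almost everywhere. *)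
Lemma ae_null_ysection (B : set (T1 * T2)) : measurable B ->
  {ae m1, forall x, m2 (xsection B x) = 0} ->
  {ae m2, forall y, m1 (ysection B y) = 0}.
Proof.
move=> mB B0.
have mx := measurable_fun_xsection m2 mB.
have my := measurable_fun_ysection m1 mB.
have E : \int[m1]_x m2 (xsection B x) = \int[m2]_y m1 (ysection B y).
  have := @product_measure_unique _ _ _ _ _ m1 m2 (m1 \x^ m2).
  by apply => // A1 A2 mA1 mA2; rewrite /= product_measure2E.
have : \int[m2]_y `|m1 (ysection B y)| = 0.
  under eq_integral do rewrite gee0_abs ?measure_ge0//.
  rewrite -E; under eq_integral do rewrite -[m2 _]gee0_abs ?measure_ge0//.
  by apply/(ae_eq_integral_abs _ measurableT mx); apply: aeS B0.
move=> /(ae_eq_integral_abs _ measurableT my).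
by apply: aeS => y /(_ Logic.I).
Qed.

End null_sections.

(** * The derivative at a zero of a nonnegative function *)

Section score_lemmas.
Context {R : realType}.

Lemma is_derive_nonneg_zero (a b t D : R) (f : R -> R) :
  (forall s, a <= s <= b -> 0 <= f s) -> a < t < b -> f t = 0 ->
  is_derive t 1 f D -> D = 0.
Proof.
move=> f0 /andP[at_ tb] ft0 /is_deriveP H; apply/eqP/negPn/negP => D0.
have D2 : 0 < `|D| / 2 by rewrite divr_gt0// normr_gt0.
have [r r0 Hr] := H _ D2.
pose k := Num.min (r / 2) (Num.min (t - a) (b - t)).
have k0 : 0 < k by rewrite /k !lt_min !subr_gt0 at_ tb divr_gt0.
have [kr [ka kb]] : k < r /\ k <= t - a /\ k <= b - t.
  have : k <= k by [].
  by rewrite {2}/k !le_min => /and3P[? ? ?]; split; [lra|split].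
(* A step against the sign of [D]: the estimate with tolerance [|D| / 2] would force
   [f (t + h) <= - k * |D| / 2 < 0]. *)
pose h := - Num.sg D * k.
have hk : `|h| = k by rewrite /h mulNr normrN normrM normr_sg D0 mul1r gtr0_norm.
have := Hr h; rewrite hk kr ft0 subr0 => /(_ erefl).
have -> : h * D = - (k * `|D|).
  by rewrite /h [in RHS]normrEsg; lra.
rewrite opprK ger0_norm; last first.
  rewrite addr_ge0 ?mulr_ge0 ?(ltW k0)// f0//.
  have : - k <= h <= k by rewrite -ler_norml hk.
  by move=> /andP[? ?]; apply/andP; split; lra.
have : 0 <= f (t + h).
  apply: f0; have : - k <= h <= k by rewrite -ler_norml hk.
  by move=> /andP[? ?]; apply/andP; split; lra.
have : 0 < k * `|D| by rewrite mulr_gt0// normr_gt0.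
lra.
Qed.

End score_lemmas.

(** * The inequality for a single weight function *)

Section weighted_cramer_rao.
Context {R : realType} d (X : measurableType d).
Variable nu : {sigma_finite_measure set X -> \bar R}.
Variables (t1 t2 : R) (p : X -> R -> R) (pe qe : R) (th : X -> R) (a a' : R -> R).
Local Notation Y := (measurableTypeR R).
Local Notation mu := (@lebesgue_measure R).
Local Notation T := (`[t1, t2]%classic : set Y).
Hypotheses (t12 : t1 < t2)
  (p0 : forall t, t \in `[t1, t2] -> forall x, 0 <= p x t)
  (p1 : forall t, t \in `[t1, t2] -> (\int[nu]_x (p x t)%:E = 1)%E)
  (mp : measurable_fun [set: X * Y] (fun z => p z.1 z.2))
  (acp : {ae nu, forall x, abs_cont_on t1 t2 (p x)})
  (pe1 : 1 < pe) (qe1 : 1 < qe) (peqe : pe^-1 + qe^-1 = 1)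
  (mth : measurable_fun [set: X] th)
  (aA : classA t1 t2 a a').

Let mT : measurable T. Proof. exact: measurable_itv. Qed.

(* [U] is [a' + a * score] extended by [0] outside [T]; the power [-1] agrees
   with the inverse where [p x t >= 0] and is known to be measurable. For almost
   every [x], [W - Z] is the derivative of [a t * p x t * (th x - t)]. *)
Let A : Y -> R := a \_ T.
Let A' : Y -> R := a' \_ T.
Let U x t : R := A' t + A t * (mderiv p x t * p x t `^ (-1)).
Let W (z : X * Y) : R := U z.1 z.2 * p z.1 z.2 * (th z.1 - z.2).
Let Z (z : X * Y) : R := A z.2 * p z.1 z.2.

Let AT t : T t -> A t = a t. Proof. by move=> Tt; rewrite /A patchE mem_set. Qed.
Let A'T t : T t -> A' t = a' t. Proof. by move=> Tt; rewrite /A' patchE mem_set. Qed.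
Let ANT t : ~ T t -> A t = 0. Proof. by move=> Tt; rewrite /A patchE memNset. Qed.
Let A'NT t : ~ T t -> A' t = 0. Proof. by move=> Tt; rewrite /A' patchE memNset. Qed.

Let UNT x t : ~ T t -> U x t = 0.
Proof. by move=> Tt; rewrite /U ANT// A'NT// mul0r addr0. Qed.

Let mA : measurable_fun [set: Y] A.
Proof.
have [aca _ _ _ _] := aA.
have ma : measurable_fun T (a : Y -> R) := abs_cont_measurable (ltW t12) aca.
exact: (measurable_restrictT (a : Y -> R) mT).1 ma.
Qed.

Let mA' : measurable_fun [set: Y] A'.
Proof.
have [_ [ia' _] _ _ _] := aA.
have ma' : measurable_fun T (a' : Y -> R).
  by apply/measurable_EFinP; exact: (measurable_int _ ia').
exact: (measurable_restrictT (a' : Y -> R) mT).1 ma'.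
Qed.

Let mAz : measurable_fun [set: X * Y] (fun z => A z.2).
Proof. exact: (measurableT_comp mA measurable_snd). Qed.

Let mA'z : measurable_fun [set: X * Y] (fun z => A' z.2).
Proof. exact: (measurableT_comp mA' measurable_snd). Qed.

Let mU : measurable_fun [set: X * Y] (fun z => U z.1 z.2).
Proof.
apply: measurable_funD => //; apply: measurable_funM => //; apply: measurable_funM.
  exact: measurable_mderiv.
exact: (measurableT_comp (measurable_powR (-1)) mp).
Qed.

Let mW : measurable_fun [set: X * Y] W.
Proof.
apply: measurable_funM; first exact: measurable_funM.
apply: measurable_funB; first exact: (measurableT_comp mth measurable_fst).
exact: (measurable_snd : measurable_fun [set: X * Y] (snd : X * Y -> Y)).
Qed.

Let mZ : measurable_fun [set: X * Y] Z.
Proof. exact: measurable_funM. Qed.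

Let px t : measurable_fun [set: X] (p ^~ t).
Proof. exact: (measurable_fun_pair1 t mp). Qed.

Let Ux t : measurable_fun [set: X] (U ^~ t).
Proof. exact: (measurable_fun_pair1 t mU). Qed.

(** Absolute continuity gives, for almost every [x], differentiability at almost every [t]. The
    exceptional set [B] is measurable, so [ae_null_ysection] exchanges the two quantifiers. *)
Lemma ae_derive1_mderiv : {ae mu, forall t, T t ->
  {ae nu, forall x, derive1 (p x) t = mderiv p x t}}.
Proof.
have [N [mN N0 acN]] := acp.
pose B : set (X * Y) := (~` N `*` `]t1, t2[%classic) `&` ~` rat_derivable p.
have mB : measurable B.
  apply: measurableI; last by apply: measurableC; exact: measurable_rat_derivable.
  by apply: measurableX; [exact: measurableC|exact: measurable_itv].
have B0 : {ae nu, forall x, mu (xsection B x) = 0%E}.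
  apply: aeW => x.
  have [Nx|Nx] := pselect (N x).
    rewrite (_ : xsection B x = set0) ?measure0//.
    by apply/seteqP; split=> // t; rewrite /xsection/= inE => -[[]].
  have acx : abs_cont_on t1 t2 (p x).
    by apply: contrapT => h; apply: Nx; exact: acN.
  have [N' [mN' N'0 dN']] := abs_cont_ae_derivable (ltW t12) acx.
  apply/eqP; rewrite eq_le measure_ge0 andbT -N'0; apply: le_measure; rewrite ?inE//.
    exact: measurable_xsection.
  move=> t; rewrite /xsection/= inE => -[[_ /=]]; rewrite in_itv/= => tt nG.
  apply: dN' => /= dt; apply: nG.
  have dtx : is_derive t 1 (p x) ('D_1 (p x) t) by exact/derivableP/dt.
  by have [_] := is_derive_rat_derivable dtx.
have := aeI (ae_null_ysection mB B0) (aeI (ae_neq t1) (ae_neq t2)).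
apply: aeS => t [Bt0 [tt1 tt2]] /=; rewrite in_itv/= => /andP[t1t tt2'].
have tt : t1 < t < t2 by rewrite !lt_neqAle t1t tt2' tt2 eq_sym tt1.
exists (N `|` ysection B t); split.
- by apply: measurableU => //; exact: measurable_ysection.
- by apply: null_set_setU => //; exact: measurable_ysection.
- move=> x /=; apply: contra_notP => /not_orP[Nx Btx].
  have acx : abs_cont_on t1 t2 (p x).
    by apply: contrapT => h; apply: Nx; exact: acN.
  rewrite derive1E; apply: derive_val; apply: (rat_derivable_is_derive acx tt).
  apply: contrapT => nG; apply: Btx; rewrite /ysection/= inE; split=> //.
Qed.

(** The integral is the increment of [a t * p x t * (th x - t)] over [T], and [a] vanishes at both
    endpoints. *)
Lemma section_integral0 x : abs_cont_on t1 t2 (p x) ->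
  (\int[mu]_t (W (x, t) - Z (x, t))%:E = 0)%E.
Proof.
move=> acx; have [aca wa _ a1 a2] := aA.
pose f t := a t * p x t * (th x - t).
have acf : abs_cont_on t1 t2 f.
  apply: abs_cont_onM; first exact: abs_cont_onM.
  by apply: abs_cont_onB; [exact: abs_cont_on_cst|exact: abs_cont_on_id].
have mh : measurable_fun [set: Y] (fun t => W (x, t) - Z (x, t)).
  apply: measurable_funB; first exact: (measurable_fun_pair2 x mW).
  exact: (measurable_fun_pair2 x mZ).
have [|_] := abs_cont_FTC (ltW t12) acf (measurable_funTS (D := T) mh).
  have := aeI (weak_deriv_ae_is_derive wa) (abs_cont_ae_derivable (ltW t12) acx).
  apply: aeS => t [Ha Hp] tt _.
  have da := Ha tt.
  have dp : is_derive t 1 (p x) ('D_1 (p x) t) by apply: derivableP; exact: Hp.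
  have [mE _] := is_derive_rat_derivable dp.
  have Tt : T t by rewrite /= in_itv/=; case/andP: tt => /ltW -> /ltW ->.
  have dl : is_derive t 1 (fun s : R => th x - s) (- 1).
    by rewrite -[X in is_derive _ _ _ X]sub0r; apply: is_deriveB.
  have := is_deriveM (is_deriveM da dp) dl.
  rewrite derive1E => -[_ fE].
  rewrite [RHS](_ : _ = 'D_1 (a * p x * (fun s => th x - s)) t)//.
  rewrite fE /W /Z /= /U AT// A'T// mE /GRing.scale/=.
  have -> : (a * p x)%R t = a t * p x t by [].
  (* At a zero of [p x] both [W] and [Z] vanish whatever the score is; the product rule agrees, as
     the nonnegative [p x] has a minimum there. *)
  have [pt0|pt0] := eqVneq (p x t) 0.
    have -> : 'D_1 (p x) t = 0.
      apply: is_derive_nonneg_zero tt pt0 dp => s st; apply: p0.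
      by rewrite in_itv.
    by rewrite pt0 !(mul0r, mulr0, addr0, subr0).
  rewrite powR_inv1 ?p0//.
  have -> : (a' t + a t * ('D_1 (p x) t / p x t)) * p x t =
      a' t * p x t + a t * 'D_1 (p x) t.
    by rewrite mulrDl -!mulrA mulVf// mulr1.
  lra.
rewrite /f a1 a2 !mul0r subrr => E0.
rewrite -[RHS]E0 [RHS]integral_mkcond; apply: eq_integral => t _.
rewrite patchE; case: ifPn => // /negP; rewrite inE => Tt.
by rewrite /W /Z /= UNT// ANT// !mul0r subrr.
Qed.

(** Measurable counterpart of the moment of [a' + a * score] under the density [p(., t)]. *)
Let H t := (\int[nu]_x (`|U x t| `^ qe * p x t)%:E)%E.

Let qe0 : 0 < qe. Proof. exact: lt_trans qe1. Qed.
Let pe0 : 0 < pe. Proof. exact: lt_trans pe1. Qed.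

Let HNT t : ~ T t -> H t = 0%E.
Proof.
move=> Tt; rewrite /H; apply: integral0_eq => x _.
by rewrite UNT// normr0 powR0 ?gt_eqF// mul0r.
Qed.

Let Hx_ge0 x t : 0 <= `|U x t| `^ qe * p x t.
Proof.
have [Tt|Tt] := pselect (T t); first by rewrite mulr_ge0 ?powR_ge0// p0.
by rewrite UNT// normr0 powR0 ?gt_eqF// mul0r.
Qed.

Let H_ge0 t : (0 <= H t)%E.
Proof. by apply: integral_ge0 => x _; rewrite lee_fin. Qed.

Let mHz : measurable_fun [set: X * Y] (fun z => `|U z.1 z.2| `^ qe * p z.1 z.2).
Proof.
apply: measurable_funM => //; apply: (measurableT_comp (measurable_powR qe)).
exact: measurableT_comp mU.
Qed.

Let mH : measurable_fun [set: Y] H.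
Proof.
have := @measurable_fun_fubini_tonelli_G _ _ X Y R nu
  (fun z => (`|U z.1 z.2| `^ qe * p z.1 z.2)%:E).
by apply => [|z]; [exact/measurable_EFinP|rewrite lee_fin].
Qed.

Let mHq : measurable_fun [set: Y] (fun t => (H t `^ qe^-1)%E).
Proof. exact: (measurableT_comp (measurable_poweR qe^-1) mH). Qed.

(** The right-hand integrands contain [derive1] and may fail to be measurable, so the nonmeasurable
    comparison is applied twice, in [t] and then in [x]. *)
Lemma le_denominator : (\int[mu]_t H t `^ qe^-1 <= \int[mu]_(t in T)
  (Expt nu p t (fun x => `|a' t + a t * score p t x| `^ qe)%R) `^ qe^-1)%E.
Proof.
have -> : (\int[mu]_t H t `^ qe^-1 = \int[mu]_(t in T) H t `^ qe^-1)%E.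
  rewrite [RHS]integral_mkcond; apply: eq_integral => t _.
  rewrite patchE; case: ifPn => // /negP; rewrite inE => Tt.
  by rewrite HNT// poweR0r// invr_neq0// gt_eqF.
apply: ae_ge0_le_integral_nonmeasurable => //.
- exact: measurable_funTS.
- by move=> t _; exact: poweR_ge0.
- by move=> t _; exact: poweR_ge0.
apply: aeS ae_derive1_mderiv => t Ht Tt.
have Et0 x : 0 <= `|a' t + a t * score p t x| `^ qe * p x t.
  by rewrite mulr_ge0 ?powR_ge0// p0.
apply: gt0_ler_poweR.
- by rewrite invr_ge0 ltW.
- by rewrite in_itv/= leey andbT.
- by rewrite in_itv/= leey andbT; apply: integral_ge0 => x _; rewrite lee_fin.
apply: ae_ge0_le_integral_nonmeasurable => //.
- exact/measurable_EFinP/(measurable_fun_pair1 t mHz).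
- by move=> x _; rewrite lee_fin.
- by move=> x _; rewrite lee_fin.
apply: aeS (Ht Tt) => x Hx _; rewrite lee_fin /U AT// A'T// -Hx /score.
by rewrite powR_inv1// p0.
Qed.

(** For fixed [t] in [T], [weighted_hoelder] with weight [p(., t)] separates [U] from [th x - t],
    whose moment is at most [M]; outside [T] the left integrand is [0]. *)
Lemma tonelli_hoelder (M : \bar R) : (0 <= M)%E ->
  (forall t, T t -> (Expt nu p t (fun x => `|th x - t| `^ pe)%R <= M)%E) ->
  (\int[mu]_t \int[nu]_x `|(W (x, t))%:E| <=
   (\int[mu]_t H t `^ qe^-1) * M `^ pe^-1)%E.
Proof.
move=> M0 HM.
have mWx : measurable_fun [set: X * Y] (fun z => `|(W z)%:E|%E).
  by apply: measurableT_comp => //; exact/measurable_EFinP.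
rewrite -ge0_integralZr//; last 2 first.
  by move=> t _; exact: poweR_ge0.
  exact: poweR_ge0.
apply: ge0_le_integral => //.
- by move=> t _; exact: integral_ge0.
- have := @measurable_fun_fubini_tonelli_G _ _ X Y R nu (fun z => `|(W z)%:E|%E).
  exact.
- by apply: emeasurable_funM => //; exact: measurable_cst.
move=> t _; have [Tt|Tt] := pselect (T t); last first.
  rewrite integral0_eq ?mule_ge0 ?poweR_ge0// => x _.
  by rewrite /W /= UNT// !mul0r normr0.
have mw : measurable_fun [set: X] (fun x => th x - t).
  by apply: measurable_funB => //; exact: measurable_cst.
apply: (le_trans (weighted_hoelder nu (Ux t) mw (px t) (p0 Tt) pe0 qe0 peqe)).
apply: lee_pmul => //; [exact: poweR_ge0..|].
apply: gt0_ler_poweR.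
- by rewrite invr_ge0 ltW.
- rewrite in_itv/= leey andbT; apply: integral_ge0 => x _.
  by rewrite lee_fin mulr_ge0 ?powR_ge0// p0.
- by rewrite in_itv/= leey andbT.
- exact: HM.
Qed.

Lemma integral_weight_le (M : \bar R) (M0 : (0 <= M)%E) (Moo : (M < +oo)%E)
  (HM : forall t, T t -> (Expt nu p t (fun x => `|th x - t| `^ pe)%R <= M)%E)
  (Doo : (\int[mu]_(t in T) (Expt nu p t
    (fun x => `|a' t + a t * score p t x| `^ qe)%R) `^ qe^-1 < +oo)%E) :
  (`| \int[mu]_(t in T) (a t)%:E | <= (\int[mu]_(t in T)
    (Expt nu p t (fun x => `|a' t + a t * score p t x| `^ qe)%R) `^ qe^-1)
    * M `^ pe^-1)%E.
Proof.
have WD := tonelli_hoelder M0 HM.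
have {}WD := le_trans WD (lee_wpmul2r (poweR_ge0 M pe^-1) le_denominator).
set D := (\int[mu]_(t in T) _)%E in Doo WD *.
have D0 : (0 <= D)%E by apply: integral_ge0 => t _; exact: poweR_ge0.
have mEW : measurable_fun [set: X * Y] (EFin \o W) by exact/measurable_EFinP.
have mEZ : measurable_fun [set: X * Y] (EFin \o Z) by exact/measurable_EFinP.
(* Finiteness of [M] and of the denominator makes [W] integrable on the product, which is what
   Fubini requires. *)
have iW : (nu \x mu)%E.-integrable setT (EFin \o W).
  apply/integrable21ltyP => //; apply: (le_lt_trans WD).
  by rewrite lte_mul_pinfty ?ge0_fin_numE// poweR_lty.
have [aca _ _ a1 a2] := aA.
have ip t : T t -> nu.-integrable setT (EFin \o p ^~ t).
  move=> Tt; apply/integrableP; split; first exact/measurable_EFinP.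
  under eq_integral do rewrite gee0_abs ?lee_fin ?p0//.
  by rewrite p1// ltry.
have intZ t : (\int[nu]_x (Z (x, t))%:E = (A t)%:E)%E.
  rewrite /Z/=; have [Tt|Tt] := pselect (T t); last first.
    by rewrite ANT// integral0_eq// => x _; rewrite mul0r.
  under eq_integral do rewrite EFinM.
  by rewrite integralZl ?p1 ?mule1//; exact: ip.
have intnZ t : (\int[nu]_x `|(Z (x, t))%:E| = `|(A t)%:E|)%E.
  rewrite /Z/=; have [Tt|Tt] := pselect (T t); last first.
    by rewrite ANT// normr0 integral0_eq// => x _; rewrite mul0r normr0.
  under eq_integral do rewrite normrM EFinM (ger0_norm (p0 Tt _)).
  by rewrite integralZl ?p1 ?mule1//; exact: ip.
have iA : mu.-integrable setT (EFin \o A).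
  rewrite /A -restrict_EFin; apply/(integrable_mkcond _ mT).
  have [K K0 aK] := abs_cont_on_bounded aca.
  have ma : measurable_fun T (EFin \o (a : Y -> R)).
    by apply/measurable_EFinP; exact: (abs_cont_measurable (ltW t12) aca).
  apply/integrableP; split => //.
  apply: (@le_lt_trans _ _ (K%:E * mu T)%E).
    apply: integral_le_bound => //.
    by apply: aeW => t Tt; rewrite lee_fin aK//; move: Tt; rewrite /= in_itv.
  by rewrite lte_mul_pinfty// lebesgue_measure_itv/= lte_fin t12 -EFinB ltry.
have iZ : (nu \x mu)%E.-integrable setT (EFin \o Z).
  apply/integrable21ltyP => //; under eq_integral do rewrite intnZ.
  by have /integrableP[] := iA.
have iWZ : (nu \x mu)%E.-integrable setT (fun z => (W z - Z z)%:E).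
  exact: (integrableB measurableT iW iZ).
(* Integrate over [t] first: the inner integral is [0] for almost every [x]. *)
have WZ0 : (\int[nu \x mu]_z (W z - Z z)%:E = 0)%E.
  rewrite -(integral12_prod_meas1 iWZ).
  rewrite (@ae_eq_integral _ _ _ nu setT (cst 0%E))//.
  - by rewrite integral0.
  - exact: (measurable_fubini_F iWZ).
  - by apply: aeS acp => x /section_integral0.
have WZ : (\int[nu \x mu]_z (W z)%:E = \int[nu \x mu]_z (Z z)%:E)%E.
  move: WZ0; under eq_integral do rewrite EFinB.
  rewrite integralB_EFin// => /eqP.
  have fW := integrable_fin_num measurableT iW.
  have fZ := integrable_fin_num measurableT iZ.
  by rewrite sube_eq ?add0e ?fin_num_adde_defl// => /eqP.
(* Integrate over [x] first: [p(., t)] has total mass [1], which leaves [a t]. *)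
have -> : (\int[mu]_(t in T) (a t)%:E = \int[nu \x mu]_z (Z z)%:E)%E.
  rewrite -(integral21_prod_meas1 iZ) integral_mkcond; apply: eq_integral => t _.
  by rewrite /fubini_G/= intZ /A restrict_EFin.
rewrite -WZ; apply: (le_trans (le_abse_integral _ _ _)) => //.
rewrite (@fubini_tonelli2 _ _ _ _ _ nu mu (fun z => `|(W z)%:E|%E))//.
exact: measurableT_comp.
Qed.

End weighted_cramer_rao.

(** A convertible alias of [nu], so that the hypothesis [sigma_finite setT nu] can be registered as
    the structure that Fubini's theorem expects. *)
Definition sigma_finite_copy d (X : measurableType d) (R : realType)
  (nu : {measure set X -> \bar R}) & sigma_finite setT nu : set X -> \bar R := nu.

Section sigma_finite_copy.
Context d (X : measurableType d) (R : realType) (nu : {measure set X -> \bar R}).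
Hypothesis sfnu : sigma_finite setT nu.

HB.instance Definition _ := Measure.copy (sigma_finite_copy sfnu) nu.
HB.instance Definition _ :=
  Measure_isSigmaFinite.Build _ _ _ (sigma_finite_copy sfnu) sfnu.

End sigma_finite_copy.

(** * From a single weight to the supremum over [classA] *)

Theorem theorem3 (R : realType) (d : measure_display) (X : measurableType d)
  (nu : {measure set X -> \bar R}) (t1 t2 : R) (p : X -> R -> R) (pe qe : R)
  (th : X -> R) :
  sigma_finite setT nu ->
  t1 < t2 ->
  (* p(., t) is a probability density w.r.t. nu for every t in T *)
  (forall t, t \in `[t1, t2] -> forall x, 0 <= p x t) ->
  (forall t, t \in `[t1, t2] -> (\int[nu]_x (p x t)%:E = 1)%E) ->
  (* p is (jointly) measurable *)
  measurable_fun setT (fun z : X * R => p z.1 z.2) ->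
  (* t |-> p(x, t) absolutely continuous on T for nu-a.e. x *)
  {ae nu, forall x, abs_cont_on t1 t2 (p x)} ->
  (* Fisher information finite, integrable over T, absolutely continuous *)
  (forall t, t \in `[t1, t2] -> (fisher nu p t < +oo)%E) ->
  (\int[@lebesgue_measure R]_(t in `[t1, t2]%classic) fisher nu p t < +oo)%E ->
  abs_cont_on t1 t2 (fun t => fine (fisher nu p t)) ->
  (* conjugate exponents *)
  1 < pe -> 1 < qe -> pe^-1 + qe^-1 = 1 ->
  (* t |-> E_{P_t} |rho_t|^q finite and integrable over T *)
  (forall t, t \in `[t1, t2] ->
     (Expt nu p t (fun x => `|score p t x| `^ qe)%R < +oo)%E) ->
  (@lebesgue_measure R).-integrable `[t1, t2]%classic
     (fun t => Expt nu p t (fun x => `|score p t x| `^ qe)%R) ->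
  (* the estimator *)
  measurable_fun setT th ->
  (ereal_sup
     [set r | exists a a' : R -> R, classA t1 t2 a a' /\
        r = ((`| \int[@lebesgue_measure R]_(t in `[t1, t2]%classic) (a t)%:E |)
             * (\int[@lebesgue_measure R]_(t in `[t1, t2]%classic)
                 (Expt nu p t (fun x => `|a' t + a t * score p t x| `^ qe)%R)
                   `^ qe^-1)^-1) `^ pe]
   <= ereal_sup [set Expt nu p t (fun x => `|th x - t| `^ pe)%R
                 | t in `[t1, t2]%classic])%E.
Proof.
move=> sfnu t12 p0 p1 mp acp _ _ _ pe1 qe1 peqe _ _ mth.
set M := (X in (_ <= X)%E).
have HM t : t \in `[t1, t2] -> (Expt nu p t (fun x => `|th x - t| `^ pe)%R <= M)%E.
  by move=> tT; apply: ereal_sup_ubound; exists t.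
have M0 : (0 <= M)%E.
  have t1T : t1 \in `[t1, t2] by rewrite in_itv/= lexx ltW.
  apply: le_trans (HM _ t1T); apply: integral_ge0 => x _.
  by rewrite lee_fin mulr_ge0 ?powR_ge0 ?p0.
have pe0 : 0 < pe by exact: lt_trans pe1.
apply: ge_ereal_sup => _ [a [a' [aA ->]]].
have [->|Moo] := eqVneq M +oo%E; first by rewrite leey.
have {}Moo : (M < +oo)%E by rewrite ltey.
set N := (X in (X * _)%E); set D := (X in (X^-1)%E).
have N0 : (0 <= N)%E by exact: abse_ge0.
have D0 : (0 <= D)%E by apply: integral_ge0 => t _; exact: poweR_ge0.
(* An infinite denominator has inverse [0], so the lower bound is [0]. *)
have [->|Doo] := eqVneq D +oo%E.
  by rewrite /inve mule0 poweR0r ?gt_eqF.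
have {}Doo : (D < +oo)%E by rewrite ltey.
have ND : (N <= D * M `^ pe^-1)%E.
  exact: (@integral_weight_le _ _ _ (sigma_finite_copy sfnu) _ _ _ _ _ _ _ _ t12 p0 p1 mp acp
    pe1 qe1 peqe mth aA _ M0 Moo HM Doo).
(* A zero denominator forces [N = 0], and the extended product [0 * D^-1] is then [0]. *)
have [D00|D00] := eqVneq D 0%E.
  have -> : N = 0%E.
    by apply/eqP; rewrite eq_le N0 andbT (le_trans ND)// D00 mul0e.
  by rewrite mul0e poweR0r ?gt_eqF.
(* With [M] written as a power, monotonicity of the power [pe] reduces the claim to
   [N / D <= M^(1/pe)]. *)
have Mfin : (M = (M `^ pe^-1) `^ pe)%E.
  by rewrite -poweRrM mulVf ?gt_eqF// poweRe1.
rewrite Mfin; apply: gt0_ler_poweR; first exact: ltW.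
- by rewrite in_itv/= leey andbT mule_ge0// inve_ge0.
- by rewrite in_itv/= leey andbT poweR_ge0.
have Dfin : D \is a fin_num by rewrite ge0_fin_numE.
have Dgt0 : (0 < D)%E by rewrite lt_neqAle eq_sym D00.
have fD0 : 0 < fine D by rewrite fine_gt0// Dgt0.
by rewrite -(fineK Dfin) inver gt_eqF// lee_pdivrMr// fineK// muleC.
Qed.
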